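(* Let $S$ be a finite set. A set function $h:2^S\to\mathbb{R}^+$ is monotone if and only if it is an Extended Deep Submodular Function (EDSF). That is, the family of monotone set functions on $S$ is exactly equal to the family of EDSFs on $S$.
   Context: Notation: $\mathbb{R}^+=[0,\infty)$. Monotone set function: $f:2^S\to\mathbb{R}^+$ is monotone if $f(A)\le f(B)$ whenever $A\subseteq B\subseteq S$. Deep Submodular Function (DSF): identify $S$ with $\{1,\dots,n\}$. A DSF network with $L\ge 1$ layers is defined recursively. All activation functions $\phi:\mathbb{R}^+\to\mathbb{R}^+$ are normalized ($\phi(0)=0$), non-decreasing and concave, and may differ from node to node. - A 1-layer DSF network with $k$ output nodes computes from an input $x\in(\mathbb{R}^+)^n$ the outputs $\varphi_i(x)=\phi_i\big(\sum_{j=1}^n w_{ji}x_j\big)$, $i=1,\dots,k$, with weights $w_{ji}\ge 0$. - An $L$-layer DSF network ($L>1$) with $m$ output nodes is obtained from an $(L-1)$-layer DSF network with output nodes $\varphi_1,\dots,\varphi_k$ by appending a fully connected layer, with outputs $\psi_v(x)=\phi_v\big(\sum_{u=1}^k w_{uv}\varphi_u(x)\big)+b_v$, $v=1,\dots,m$, with weights $w_{uv}\ge 0$ and biases $b_v\in\mathbb{R}^+$. A set function $f:2^S\to\mathbb{R}^+$ is a DSF if there is a DSF network (any number of layers) with a single output node whose output on the indicator vector $\mathbf{1}_A\in\{0,1\}^n$ equals $f(A)$ for every $A\subseteq S$. Extended Deep Submodular Function (EDSF): a set function $h$ is an EDSF if there are $r\ge 1$ (arbitrary) and DSFs $f_1,\dots,f_r$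 on $S$ with $h(A)=\min\{f_1(A),\dots,f_r(A)\}$ for all $A\subseteq S$. *)

(* Defs.v *)
From mathcomp Require Import all_boot all_order all_algebra.
From mathcomp Require Import all_classical all_reals.
From mathcomp Require Import convex.

Set Implicit Arguments.
Unset Strict Implicit.
Unset Printing Implicit Defensive.

Import Order.TTheory GRing.Theory Num.Theory.

Local Open Scope ring_scope.

Definition monotone_set_fun (R : realType) (S : finType) (f : {set S} -> R) :=
  forall A B : {set S}, A \subset B -> f A <= f B.

(* A function from [0, +oo[ to itself is represented by a function on R of
   which only the restriction to [0, +oo[ is constrained. *)
Record activation (R : realType) (phi : R -> R) : Prop := Activation {
  activation_ge0 : forall x, 0 <= x -> 0 <= phi x;
  activation_normalized : phi 0 = 0;
  activation_nondecreasing : forall x y, 0 <= x -> x <= y -> phi x <= phi y;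
  activation_concave :
    convex_function (E := R^o) [set x : R | 0 <= x]%classic (fun x => - phi x)
}.

(* [dsf_network R n L m]: networks with n inputs, L layers and m output nodes.
   As in the recursive definition, the first layer carries no biases. *)
Inductive dsf_network (R : realType) (n : nat) : nat -> nat -> Type :=
| dsf_first (k : nat) (phi : 'I_k -> R -> R) (w : 'M[R]_(n, k)) of
    (forall i, activation (phi i)) &
    (forall j i, 0 <= w j i) :
    dsf_network R n 1 k
| dsf_append (L k m : nat) (N : dsf_network R n L k)
    (phi : 'I_m -> R -> R) (w : 'M[R]_(k, m)) (b : 'rV[R]_m) of
    (forall v, activation (phi v)) &
    (forall u v, 0 <= w u v) &
    (forall v, 0 <= b 0 v) :
    dsf_network R n L.+1 m.

Fixpoint dsf_eval (R : realType) (n L m : nat) (N : dsf_network R n L m)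
    (x : 'rV[R]_n) : 'rV[R]_m :=
  match N with
  | dsf_first k phi w _ _ =>
      \row_(i < k) phi i (\sum_(j < n) w j i * x 0 j)
  | dsf_append L' k m' N' phi w b _ _ _ =>
      \row_(v < m')
        (phi v (\sum_(u < k) w u v * dsf_eval N' x 0 u) + b 0 v)
  end.

(* S is identified with 'I_#|S| through the enumeration enum_val. *)
Definition indicator_row (R : realType) (S : finType) (A : {set S}) :
    'rV[R]_#|S| :=
  \row_(j < #|S|) (enum_val j \in A)%:R.

Definition is_DSF (R : realType) (S : finType) (f : {set S} -> R) : Prop :=
  exists (L : nat) (N : dsf_network R #|S| L 1),
    forall A : {set S}, f A = dsf_eval N (indicator_row R A) 0 0.

(* The r.+1 functions are indexed by 'I_r.+1, so the family is nonempty;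
   seeding the iterated minimum with its first member is then harmless. *)
Definition is_EDSF (R : realType) (S : finType) (h : {set S} -> R) : Prop :=
  exists (r : nat) (f : 'I_r.+1 -> {set S} -> R),
    (forall i, is_DSF (f i)) /\
    (forall A : {set S}, h A = \big[Num.min/f ord0 A]_(i < r.+1) f i A).

(* Main.v *)
Require Import Defs.
From mathcomp Require Import all_boot all_order all_algebra.
From mathcomp Require Import all_classical all_reals.
From mathcomp Require Import interval_inference convex lra.

Import Order.TTheory GRing.Theory Num.Theory.

Local Open Scope ring_scope.

(** Networks are monotone because every layer is, and minima of monotone
    functions are monotone. Conversely, for each [B] the function equal to
    [h B] on the subsets of [B] and to [h S] elsewhere is above [h] and
    agrees with it at [B], so [h] is the minimum of these functions; each of
    them is the two-layer network
    [h B + (h S - h B) * min(1, #|A :\: B|)]. *)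

(** Nonnegativity comes from [phi 0 = 0] and monotonicity. Concavity is taken as an explicit
    inequality, so that concrete activations can be checked by plain arithmetic. *)
Lemma activationP (R : realType) (phi : R -> R) :
    phi 0 = 0 ->
    (forall x y, 0 <= x -> x <= y -> phi x <= phi y) ->
    (forall t x y, 0 <= t -> t <= 1 -> 0 <= x -> 0 <= y ->
       t * phi x + (1 - t) * phi y <= phi (t * x + (1 - t) * y)) ->
  activation phi.
Proof.
move=> phi0 phi_nd phi_concave; split => //.
- by move=> x x0; rewrite -phi0 phi_nd.
- move=> t x y; rewrite !inE /= => x0 y0.
  have := phi_concave t%:num x y (ge0 t) (le1 t) x0 y0.
  by rewrite -lerN2 opprD -!mulrN => le_phi; exact: le_phi.
Qed.

Lemma activation_id (R : realType) : activation (@id R).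
Proof. exact: activationP. Qed.

Lemma activation_min1 (R : realType) : activation (fun x : R => Num.min 1 x).
Proof.
apply: activationP => [|x y _ xy|t x y t0 t1 _ _].
- exact/min_idPr.
- by rewrite le_min !ge_min lexx xy orbT.
(* A minimum of two affine functions is concave: the bounds by [1] and by the argument each pass to
   convex combinations. *)
- have mx1 : Num.min 1 x <= 1 by rewrite ge_min lexx.
  have mxx : Num.min 1 x <= x by rewrite ge_min lexx orbT.
  have my1 : Num.min 1 y <= 1 by rewrite ge_min lexx.
  have myy : Num.min 1 y <= y by rewrite ge_min lexx orbT.
  by rewrite le_min; apply/andP; split; nra.
Qed.

(** Activations are constrained on nonnegative reals only, so monotonicity of a layer can be used
    only once the outputs feeding it are known to be nonnegative. *)
Lemma dsf_eval_ge0 (R : realType) (n L m : nat) (N : dsf_network R n L m)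
    (x : 'rV[R]_n) (i : 'I_m) :
  (forall j, 0 <= x 0 j) -> 0 <= dsf_eval N x 0 i.
Proof.
move=> x_ge0; elim: N i => [k phi w act w_ge0 i|L' k m' N IH phi w b act w_ge0
  b_ge0 i];
  rewrite mxE ?addr_ge0 //; apply: (activation_ge0 (act i));
  by apply: sumr_ge0 => j _; apply: mulr_ge0.
Qed.

Lemma dsf_eval_le (R : realType) (n L m : nat) (N : dsf_network R n L m)
    (x y : 'rV[R]_n) (i : 'I_m) :
    (forall j, 0 <= x 0 j) -> (forall j, x 0 j <= y 0 j) ->
  dsf_eval N x 0 i <= dsf_eval N y 0 i.
Proof.
move=> x_ge0 xy; elim: N i => [k phi w act w_ge0 i|L' k m' N IH phi w b act w_ge0
  b_ge0 i];
  rewrite !mxE ?lerD2r; apply: (activation_nondecreasing (act i)).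
- by apply: sumr_ge0 => j _; apply: mulr_ge0.
- by apply: ler_sum => j _; apply: ler_wpM2l.
- by apply: sumr_ge0 => j _; apply: mulr_ge0 => //; apply: dsf_eval_ge0.
- by apply: ler_sum => j _; apply: ler_wpM2l.
Qed.

Lemma is_DSF_monotone (R : realType) (S : finType) (f : {set S} -> R) :
  is_DSF f -> monotone_set_fun f.
Proof.
move=> [L [N fE]] A B AB; rewrite !fE.
apply: dsf_eval_le => j; rewrite !mxE ?ler0n // ler_nat.
by case: (boolP (_ \in A)) => // /(fintype.subsetP AB) ->.
Qed.

Lemma is_EDSF_monotone (R : realType) (S : finType) (h : {set S} -> R) :
  is_EDSF h -> monotone_set_fun h.
Proof.
move=> [r [f [f_dsf hE]]] A B AB; rewrite !hE.
have f_le i : f i A <= f i B by exact: is_DSF_monotone.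
(* The seed [f ord0 B] of the minimum needs its own bound, which the member [ord0] provides. *)
apply: le_bigmin => [|i _]; first exact: (bigmin_inf ord0).
exact: (bigmin_inf i).
Qed.

Lemma is_DSF_two_valued (R : realType) (S : finType) (B : {set S}) (a c : R) :
    0 <= a -> a <= c ->
  is_DSF (fun A : {set S} => if A \subset B then a else c).
Proof.
move=> a_ge0 ac.
(* Elements of [B] get weight 0, so the weighted sum on the indicator of [A] counts [A :\: B]. *)
pose w1 : 'M[R]_(#|S|, 1) := \matrix_(j, i) (enum_val j \notin B)%:R.
have w1_ge0 j i : 0 <= w1 j i by rewrite mxE ler0n.
have w2_ge0 u v : 0 <= (const_mx (c - a) : 'M[R]_(1, 1)) u v.
  by rewrite mxE subr_ge0.
have b_ge0 v : 0 <= (const_mx a : 'rV[R]_1) 0 v by rewrite mxE.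
(* The second layer is there for the bias [a]: a first layer has none and, being normalized,
   vanishes on the empty set. *)
pose N := dsf_append (dsf_first (fun=> activation_min1 R) w1_ge0)
  (fun=> activation_id R) w2_ge0 b_ge0.
exists 2, N => A /=; rewrite !mxE big_ord1 !mxE /=.
under eq_bigr do rewrite !mxE -natrM mulnb.
case: ifPn => [AB|/fintype.subsetPn[x xA xNB]].
  rewrite big1 => [|j _].
    by have /min_idPr -> : (0 <= 1 :> R); rewrite ?mulr0 ?add0r.
  by case: (boolP (_ \in A)) => [/(fintype.subsetP AB) ->|_]; rewrite ?andbF.
(* One element of [A] outside [B] already saturates the truncation at 1. *)
suff /min_idPl -> : 1 <= \sum_(j < #|S|)
    ((enum_val j \notin B) && (enum_val j \in A))%:R :> R.
  by rewrite mulr1 subrK.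
rewrite (bigD1 (enum_rank x)) //= enum_rankK xA xNB lerDl.
by apply: sumr_ge0 => j _; rewrite ler0n.
Qed.

Lemma monotone_is_EDSF (R : realType) (S : finType) (h : {set S} -> R) :
  (forall A, 0 <= h A) -> monotone_set_fun h -> is_EDSF h.
Proof.
move=> h_ge0 h_mono.
(* There is one index more than there are subsets; the surplus one takes the default [[set: S]],
   which only repeats the constant function [h [set: S]]. *)
pose B i := nth [set: S] (enum {set S}) i.
pose f i (A : {set S}) := if A \subset B i then h (B i) else h [set: S].
have hf i A : h A <= f i A by rewrite /f; case: ifP => [|_]; apply: h_mono.
exists #|{set S}|, (fun i => f i); split=> [i|A].
  by apply: is_DSF_two_valued => //; apply: h_mono.
apply: le_anti; apply/andP; split; first exact: le_bigmin.
have iA : (index A (enum {set S}) < #|{set S}|.+1)%N.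
  by rewrite ltnS cardE index_size.
apply: (bigmin_inf (Ordinal iA)) => //.
by rewrite /f /B nth_index ?mem_enum // fintype.subxx.
Qed.

Theorem theorem3p2 (R : realType) (S : finType) (h : {set S} -> R)
    (h_ge0 : forall A : {set S}, 0 <= h A) :
  monotone_set_fun h <-> is_EDSF h.
Proof. by split; [exact: monotone_is_EDSF | exact: is_EDSF_monotone]. Qed.
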